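(* For $A, B \in M_+(n,\mathbb{C})$ and an integer $m \geq 1$, we have $$\int_0^1 A\#_{\nu}B\,d\nu \geq \frac{1}{m}\sum_{k=1}^m A\#_{(2k-1)/(2m)}B \geq \frac{1}{m} \sum_{k=1}^m A\#_{k/(m+1)}B \geq A\#_{1/2}B.$$
   Context: $M_+(n,\mathbb{C})$ is the set of all $n\times n$ positive semidefinite complex matrices. For $0\le\nu\le1$, $A\#_{\nu}B \equiv A^{1/2}(A^{-1/2}BA^{-1/2})^{\nu}A^{1/2}$ is the $\nu$-weighted geometric mean introduced by Kubo and Ando. Inequalities between Hermitian matrices are in the Loewner order ($S\le T$ means $T-S$ is positive semidefinite). Powers are defined by the functional calculus and the integral is taken entrywise. *)

(* Defs.v *)
From HB Require Import structures.
From mathcomp Require Export all_boot all_order all_algebra.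
From mathcomp Require Export all_classical all_reals all_analysis.
From mathcomp Require Export sesquilinear spectral.
From mathcomp Require Export complex.
Export Order.TTheory GRing.Theory Num.Theory.
Export numFieldNormedType.Exports.

Set Implicit Arguments.
Unset Strict Implicit.
Unset Printing Implicit Defensive.

Local Open Scope ring_scope.
Local Open Scope sesquilinear_scope.
Local Open Scope complex_scope.
Local Open Scope classical_set_scope.

(* In the order of R[i], 0 <= z says that z is real and nonnegative. *)
Definition psdmx (R : realType) (n : nat) (A : 'M[R[i]]_n) : Prop :=
  A \is hermsymmx /\ forall x : 'cV[R[i]]_n, 0 <= (x ^t* *m A *m x) 0 0.

Definition loewner_le (R : realType) (n : nat) (S T : 'M[R[i]]_n) : Prop :=
  psdmx (T - S).

(* A ^ p for A positive semidefinite (when A is singular, p >= 0):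
   if A = U^-1 diag(d) U with U unitary, then A ^ p = U^-1 diag(d ^ p) U.
   Then d has nonnegative real entries, so that taking real parts loses
   nothing; powR has 0 `^ 0 = 1, hence A ^ 0 = 1 even for singular A. *)
Definition mxpow (R : realType) (n : nat) (A : 'M[R[i]]_n) (p : R) :
    'M[R[i]]_n :=
  invmx (spectralmx A)
  *m diag_mx (map_mx (fun z : R[i] => (complex.Re z `^ p)%:C) (spectral_diag A))
  *m spectralmx A.

(* A^{1/2} (A^{-1/2} B A^{-1/2})^nu A^{1/2}, meaningful for A invertible. *)
Definition wgmean_pd (R : realType) (n : nat) (A B : 'M[R[i]]_n) (nu : R) :
    'M[R[i]]_n :=
  mxpow A (2^-1)
  *m mxpow (mxpow A (- 2^-1) *m B *m mxpow A (- 2^-1)) nu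
  *m mxpow A (2^-1).

Definition mxlim_right0 (R : realType) (n : nat) (F : R -> 'M[R[i]]_n) :
    'M[R[i]]_n :=
  \matrix_(i < n, j < n)
    (lim (complex.Re (F e i j) @[e --> 0^'+]) +i*
     lim (complex.Im (F e i j) @[e --> 0^'+])).

(* The Kubo-Ando weighted geometric mean of positive semidefinite matrices.
   The closed formula requires A to be invertible; for singular A the mean is,
   as for every Kubo-Ando mean, the limit as e decreases to 0 of the mean of
   A + e I and B + e I (for invertible A this limit is the formula itself). *)
Definition wgmean (R : realType) (n : nat) (A B : 'M[R[i]]_n) (nu : R) :
    'M[R[i]]_n :=
  if A \in unitmx then wgmean_pd A B nu
  else mxlim_right0 (fun e : R => wgmean_pd (A + e%:C%:M) (B + e%:C%:M) nu).

Definition mxint01 (R : realType) (n : nat) (F : R -> 'M[R[i]]_n) :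
    'M[R[i]]_n :=
  \matrix_(i < n, j < n)
    ((\int[lebesgue_measure]_(t in `[0%R, 1%R]) complex.Re (F t i j)) +i*
     (\int[lebesgue_measure]_(t in `[0%R, 1%R]) complex.Im (F t i j))).

(* Main.v *)
(* Put <M x, x> for the quadratic form of a Hermitian matrix M.  When A is
   invertible, t |-> <(A #_t B) x, x> is a nonnegative combination of functions
   t |-> l ^ t with l >= 0, so everything reduces to l ^ t = exp (t L).  The
   integral inequality then amounts to sinh y >= y (both sides are geometric
   sums), and the two others follow by pairing k with m + 1 - k: the paired
   exponents are 1/2 + s and 1/2 - s, and exp (s L) + exp (- s L) increases
   with |s|.

   When A is singular, the limit defining A #_t B has to be shown to exist.
   The mean of positive definite matrices is monotone: the set of exponents t
   for which A <= A' and B <= B' imply A #_t B <= A' #_t B' contains 0 and 1, is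
   closed, and is closed under midpoints, because A #_c B with c = (a + b) / 2
   is the positive X solving X (A #_a B)^-1 X = A #_b B, and such an X is
   monotone in the two data.  Hence the quadratic forms of
   (A + e I) #_t (B + e I) decrease with e, the entries converge by
   polarization, and dominated convergence gives the integral inequality. *)
From HB Require Import structures.
Require Import Defs.
From mathcomp Require Import ring lra measurable_realfun.

Set Implicit Arguments.
Unset Strict Implicit.
Unset Printing Implicit Defensive.

Local Open Scope ring_scope.
Local Open Scope sesquilinear_scope.
Local Open Scope complex_scope.

(* Locked because unification otherwise unfolds the conjugation of R[i], which
   makes rewriting with matrix products intractable. *)
HB.lock Definition adj (R : realType) m n (M : 'M[R[i]]_(m, n)) : 'M[R[i]]_(n, m) :=
  M ^t*.
Notation "M ^h" := (adj M) (at level 30, format "M ^h").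

(** * Quadratic forms and powers of Hermitian matrices *)

Section QuadraticForms.
Variable R : realType.
Implicit Types (m n : nat).

Lemma adjE m n (A : 'M[R[i]]_(m, n)) : A ^t* = A ^h.
Proof. by rewrite adj.unlock. Qed.

Lemma adjK m n (A : 'M[R[i]]_(m, n)) : A ^h ^h = A.
Proof. by rewrite -!adjE trmxCK. Qed.

Lemma adj_mxE m n (A : 'M[R[i]]_(m, n)) i j : A ^h i j = (A j i)^*.
Proof. by rewrite -adjE !mxE. Qed.

Lemma adjM m n p (A : 'M[R[i]]_(m, n)) (B : 'M[R[i]]_(n, p)) :
  (A *m B) ^h = B ^h *m A ^h.
Proof. rewrite adj.unlock; by rewrite trmx_mul map_mxM. Qed.

Lemma hermP n (M : 'M[R[i]]_n) : M \is hermsymmx <-> M ^h = M.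
Proof.
rewrite adj.unlock.
split=> [/is_hermitianmxP|h].
  by rewrite expr0 scale1r => <-.
by apply/is_hermitianmxP; rewrite expr0 scale1r h.
Qed.

Lemma real_complexE0 (z : R[i]) : z^* = z -> z = (complex.Re z)%:C.
Proof. by case: z => a b [] /eqP; rewrite eqNr => /eqP ->. Qed.

Lemma ReD (z w : R[i]) : complex.Re (z + w) = complex.Re z + complex.Re w.
Proof. by case: z; case: w. Qed.

Lemma ReN (z : R[i]) : complex.Re (- z) = - complex.Re z.
Proof. by case: z. Qed.

Lemma Re_sum (I : Type) (r : seq I) (P : pred I) (F : I -> R[i]) :
  complex.Re (\sum_(i <- r | P i) F i) = \sum_(i <- r | P i) complex.Re (F i).
Proof. by apply: (big_morph _ ReD). Qed.

Lemma ReZ (r : R) (z : R[i]) : complex.Re (r%:C * z) = r * complex.Re z.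
Proof. by case: z => a b /=; rewrite mul0r subr0. Qed.

(** Taking the real part gives an additive form with values in the ordered field [R]; for Hermitian
    [M] nothing is lost, by [qf_herm]. *)
Definition qf n (M : 'M[R[i]]_n) (x : 'cV[R[i]]_n) : R :=
  complex.Re ((x ^h *m M *m x) 0 0).

Lemma qf_herm n (M : 'M[R[i]]_n) x :
  M ^h = M -> (x ^h *m M *m x) 0 0 = (qf M x)%:C.
Proof.
move=> hM; apply: real_complexE0.
have : (x ^h *m M *m x) ^h = x ^h *m M *m x.
  by rewrite !adjM adjK hM mulmxA.
by move=> /matrixP /(_ 0 0); rewrite adj_mxE.
Qed.

Lemma psdmxP n (M : 'M[R[i]]_n) :
  psdmx M <-> M ^h = M /\ forall x, 0 <= qf M x.
Proof.
have E x : (x ^t* *m M *m x) 0 0 = (x ^h *m M *m x) 0 0 by rewrite adjE.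
split=> [[/hermP hM h]|[hM h]].
  by split=> // x; have := h x; rewrite E qf_herm// ler0c.
by split=> [|x]; [exact/hermP|rewrite E qf_herm// ler0c].
Qed.

Lemma qfD n (M N : 'M[R[i]]_n) x : qf (M + N) x = qf M x + qf N x.
Proof. by rewrite /qf mulmxDr mulmxDl mxE ReD. Qed.

Lemma qfN n (M : 'M[R[i]]_n) x : qf (- M) x = - qf M x.
Proof. by rewrite /qf mulmxN mulNmx mxE ReN. Qed.

Lemma qfB n (M N : 'M[R[i]]_n) x : qf (M - N) x = qf M x - qf N x.
Proof. by rewrite qfD qfN. Qed.

Lemma qf0 n (x : 'cV[R[i]]_n) : qf 0 x = 0.
Proof. by rewrite /qf mulmx0 mul0mx mxE. Qed.

Lemma qfZ n (r : R) (M : 'M[R[i]]_n) x : qf (r%:C *: M) x = r * qf M x.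
Proof. by rewrite /qf -scalemxAr -scalemxAl mxE ReZ. Qed.

Lemma qf_sum n (I : Type) (r : seq I) (P : pred I) (F : I -> 'M[R[i]]_n) x :
  qf (\sum_(i <- r | P i) F i) x = \sum_(i <- r | P i) qf (F i) x.
Proof.
apply: (big_morph (fun M => qf M x)) => [M N|]; [exact: qfD|exact: qf0].
Qed.

Lemma qf_congr n (M N : 'M[R[i]]_n) x : qf (N ^h *m M *m N) x = qf M (N *m x).
Proof. by rewrite /qf adjM !mulmxA. Qed.

Lemma adjD m n (A B : 'M[R[i]]_(m, n)) : (A + B) ^h = A ^h + B ^h.
Proof. by apply/matrixP => i j; rewrite !(adj_mxE, mxE) rmorphD. Qed.

Lemma adjN m n (A : 'M[R[i]]_(m, n)) : (- A) ^h = - A ^h.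
Proof. by apply/matrixP => i j; rewrite !(adj_mxE, mxE) rmorphN. Qed.

Lemma adjZ m n (r : R) (A : 'M[R[i]]_(m, n)) : (r%:C *: A) ^h = r%:C *: A ^h.
Proof.
apply/matrixP => i j; rewrite !(adj_mxE, mxE) rmorphM /=; congr (_ * _).
exact: conjc_real.
Qed.

Lemma adj_sum n (I : Type) (r : seq I) (P : pred I) (F : I -> 'M[R[i]]_n) :
  (forall i, P i -> (F i) ^h = F i) ->
  (\sum_(i <- r | P i) F i) ^h = \sum_(i <- r | P i) F i.
Proof.
move=> hF; apply: (big_ind (fun M : 'M[R[i]]_n => M ^h = M)) => //.
  by apply/matrixP => i j; rewrite !(adj_mxE, mxE) conjc0.
by move=> M N hM hN; rewrite adjD hM hN.
Qed.

Lemma loewnerP n (S T : 'M[R[i]]_n) : S ^h = S -> T ^h = T ->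
  loewner_le S T <-> forall x, qf S x <= qf T x.
Proof.
move=> hS hT; split=> [/psdmxP [_ h] x|h].
  by have := h x; rewrite qfB subr_ge0.
by apply/psdmxP; split=> [|x]; rewrite ?adjD ?adjN ?hS ?hT// qfB subr_ge0.
Qed.

Definition pdmx n (M : 'M[R[i]]_n) : Prop :=
  M ^h = M /\ forall x, x != 0 -> 0 < qf M x.

Lemma pd_psd n (M : 'M[R[i]]_n) : pdmx M -> psdmx M.
Proof.
move=> [hM h]; apply/psdmxP; split=> // x.
have [->|/h/ltW//] := eqVneq x 0.
by rewrite /qf mulmx0 mxE.
Qed.

(** A nonzero row of the kernel of [M^T], once transposed, would be a vector killed by [M], and the
    form would vanish there. *)
Lemma pd_unit n (M : 'M[R[i]]_n) : pdmx M -> M \in unitmx.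
Proof.
move=> [hM h]; rewrite -unitmx_tr -row_free_unit -kermx_eq0.
apply/eqP/row_matrixP => i; rewrite row0.
apply: contraTeq isT => nz.
pose x := (row i (kermx M^T))^T.
have x0 : x != 0 by rewrite /x trmx_eq0.
suff Mx : M *m x = 0 by have := h _ x0; rewrite /qf -mulmxA Mx mulmx0 mxE ltxx.
apply: trmx_inj; rewrite trmx_mul trmxK trmx0.
by rewrite -row_mul mulmx_ker row0.
Qed.

(** * Spectral decomposition and real powers *)

Definition nsq (z : R[i]) : R := complex.Re z ^+ 2 + complex.Im z ^+ 2.

Lemma nsq_ge0 z : 0 <= nsq z.
Proof. by rewrite addr_ge0// sqr_ge0. Qed.

Lemma nsqE z : z^* * z = (nsq z)%:C.
Proof. by case: z => a b; rewrite /nsq; simpc; rewrite /=; congr (_ +i* _); ring. Qed.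

Lemma nsq_eq0 z : (nsq z == 0) = (z == 0).
Proof. by rewrite paddr_eq0 ?sqr_ge0// !sqrf_eq0 eq_complex. Qed.

(** For unitary [U] this is the functional calculus: products and powers act on the real family [d]
    alone. *)
Definition spec n (U : 'M[R[i]]_n) (d : 'I_n -> R) : 'M[R[i]]_n :=
  U ^h *m diag_mx (\row_i (d i)%:C) *m U.

Lemma spec_adj n (U : 'M[R[i]]_n) d : (spec U d) ^h = spec U d.
Proof.
rewrite /spec !adjM adjK mulmxA; congr (_ *m _ *m _).
apply/matrixP => i j; rewrite adj_mxE !mxE eq_sym.
by case: eqVneq => [->|_]; rewrite ?mulr1n ?mulr0n ?conjc0// conjc_real.
Qed.

Lemma qf_spec n (U : 'M[R[i]]_n) d x :
  qf (spec U d) x = \sum_i d i * nsq ((U *m x) i 0).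
Proof.
rewrite /spec qf_congr; move: (U *m x) => {x}y.
rewrite /qf -mulmxA mxE Re_sum.
apply: eq_bigr => i _; rewrite mul_diag_mx adj_mxE !mxE.
by rewrite mulrCA ReZ; congr (_ * _); rewrite [X in complex.Re X]nsqE.
Qed.

Lemma unitary_adjK n (U : 'M[R[i]]_n) : U \is unitarymx -> U *m U ^h = 1%:M.
Proof. by rewrite -adjE => /unitarymxP. Qed.

Lemma unitary_adjKl n (U : 'M[R[i]]_n) : U \is unitarymx -> U ^h *m U = 1%:M.
Proof. by move=> hU; rewrite -adjE -invmx_unitary// mulVmx// unitarymx_unit. Qed.

Lemma specM n (U : 'M[R[i]]_n) d e : U \is unitarymx ->
  spec U d *m spec U e = spec U (fun i => d i * e i).
Proof.
move=> hU; rewrite /spec.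
have H (V D E : 'M[R[i]]_n) : U *m V = 1%:M ->
    V *m D *m U *m (V *m E *m U) = V *m (D *m E) *m U.
  by move=> h; rewrite -!mulmxA (mulmxA U) h mul1mx.
rewrite (H _ _ _ (unitary_adjK hU)) mulmx_diag.
by congr (_ *m diag_mx _ *m _); apply/rowP => i; rewrite !mxE -rmorphM.
Qed.

Lemma spec1 n (U : 'M[R[i]]_n) : U \is unitarymx -> spec U (fun=> 1) = 1%:M.
Proof.
move=> hU; rewrite /spec -[RHS](unitary_adjKl hU).
suff -> : \row_(i < n) (1 : R)%:C = const_mx 1 by rewrite diag_const_mx mulmx1.
by apply/rowP => i; rewrite !mxE.
Qed.

Definition eigval n (A : 'M[R[i]]_n) (i : 'I_n) : R :=
  complex.Re (spectral_diag A 0 i).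

Lemma invmx_spectral n (A : 'M[R[i]]_n) :
  invmx (spectralmx A) = (spectralmx A) ^h.
Proof. by rewrite -adjE; exact/invmx_unitary/spectral_unitarymx. Qed.

Lemma spectral_specE n (A : 'M[R[i]]_n) : A ^h = A ->
  A = spec (spectralmx A) (eigval A).
Proof.
move=> hA; have /hermP hA' := hA.
have E : \row_i (eigval A i)%:C = spectral_diag A.
  apply/rowP => i; rewrite mxE.
  by have /mxOverP/(_ 0 i)/RRe_real := hermitian_spectral_diag_real hA'.
rewrite /spec E -invmx_spectral.
by have /hermitian_normalmx /orthomx_spectralP := hA'.
Qed.

Lemma mxpowE n (A : 'M[R[i]]_n) p :
  mxpow A p = spec (spectralmx A) (fun i => eigval A i `^ p).
Proof.
rewrite /mxpow /spec -invmx_spectral.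
suff -> : \row_i (eigval A i `^ p)%:C =
  map_mx (fun z : R[i] => (complex.Re z `^ p)%:C) (spectral_diag A) by [].
by apply/rowP => i; rewrite !mxE.
Qed.

Lemma mxpow_adj n (A : 'M[R[i]]_n) p : (mxpow A p) ^h = mxpow A p.
Proof. by rewrite mxpowE spec_adj. Qed.

(** The i-th column of [U^h] is a unit eigenvector, so the form at it equals the eigenvalue;
    positivity of the form thus passes to the spectrum. *)
Lemma eigvalE n (A : 'M[R[i]]_n) (i : 'I_n) : A ^h = A ->
  let v : 'cV[R[i]]_n := (spectralmx A) ^h *m delta_mx i 0 in
  v != 0 /\ A *m v = (eigval A i)%:C *: v /\ eigval A i = qf A v.
Proof.
move=> hA v; set U := spectralmx A.
have hU : U \is unitarymx by exact: spectral_unitarymx.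
have Uv : U *m v = delta_mx i 0 by rewrite mulmxA unitary_adjK// mul1mx.
split; last split.
- apply/eqP => v0; move: Uv; rewrite v0 mulmx0 => /matrixP /(_ i 0).
  by rewrite !mxE !eqxx => /esym/eqP; rewrite oner_eq0.
- rewrite [in LHS](spectral_specE hA) /spec -!mulmxA Uv.
  rewrite -/U [RHS]scalemxAr; congr (_ *m _); apply/matrixP => j k.
  by rewrite mul_diag_mx !mxE; case: eqP => [->|]; rewrite ?mulr0.
- rewrite [in RHS](spectral_specE hA) qf_spec -/U Uv (bigD1 i)//= big1 => [|j /negPf ji].
    by rewrite !mxE !eqxx /nsq /=; ring.
  by rewrite !mxE ji /nsq /=; ring.
Qed.

Lemma eigval_ge0 n (A : 'M[R[i]]_n) i : psdmx A -> 0 <= eigval A i.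
Proof. by case/psdmxP => hA h; have [_ [_ ->]] := eigvalE i hA. Qed.

Lemma eigval_gt0 n (A : 'M[R[i]]_n) i : pdmx A -> 0 < eigval A i.
Proof. by case=> hA h; have [v0 [_ ->]] := eigvalE i hA; exact: h. Qed.

Lemma herm_psd n (A : 'M[R[i]]_n) : A ^h = A ->
  (forall (v : 'cV[R[i]]_n) (l : R), v != 0 -> A *m v = l%:C *: v -> 0 <= l) -> psdmx A.
Proof.
move=> hA h; apply/psdmxP; split=> // x.
rewrite (spectral_specE hA) qf_spec sumr_ge0// => i _.
rewrite mulr_ge0 ?nsq_ge0//; have [v0 [Av _]] := eigvalE i hA.
exact: h v0 Av.
Qed.

Lemma mxpowD n (A : 'M[R[i]]_n) p q : pdmx A ->
  mxpow A p *m mxpow A q = mxpow A (p + q).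
Proof.
move=> hA; rewrite !mxpowE (specM _ _ (spectral_unitarymx A)); congr spec.
apply/funext => i; rewrite powRD//.
by apply/implyP => _; rewrite gt_eqF// eigval_gt0.
Qed.

Lemma mxpow0 n (A : 'M[R[i]]_n) : mxpow A 0 = 1%:M.
Proof.
rewrite mxpowE -[RHS](spec1 (spectral_unitarymx A)); congr spec.
by apply/funext => i; rewrite powRr0.
Qed.

Lemma mxpow1 n (A : 'M[R[i]]_n) : psdmx A -> mxpow A 1 = A.
Proof.
move=> hA; have [h _] := (psdmxP A).1 hA.
rewrite mxpowE [RHS](spectral_specE h); congr spec.
by apply/funext => i; rewrite powRr1// eigval_ge0.
Qed.

Lemma unitary_mulx_neq0 n (U : 'M[R[i]]_n) (x : 'cV_n) : U \in unitmx ->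
  x != 0 -> U *m x != 0.
Proof.
move=> hU; apply: contra_neq => h.
by rewrite -[x](mulKmx hU) h mulmx0.
Qed.

Lemma exists_neq0 n (x : 'cV[R[i]]_n) : x != 0 -> exists i, x i 0 != 0.
Proof.
move=> /eqP x0; apply/existsP; apply: contra_notT x0 => /existsPn h.
apply/matrixP => i j; rewrite ord1 [RHS]mxE.
by apply/eqP; have := h i; rewrite negbK.
Qed.

Lemma spec_pd n (U : 'M[R[i]]_n) d : U \in unitmx -> (forall i, 0 < d i) ->
  pdmx (spec U d).
Proof.
move=> uU d0; split=> [|x x0]; first exact: spec_adj.
rewrite qf_spec.
have [i hi] := exists_neq0 (unitary_mulx_neq0 uU x0).
rewrite (bigD1 i)//= ltr_pwDl//.
  by rewrite mulr_gt0// lt_neqAle nsq_ge0 eq_sym nsq_eq0 hi.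
by rewrite sumr_ge0// => j _; rewrite mulr_ge0 ?nsq_ge0// ltW.
Qed.

Lemma mxpow_pd n (A : 'M[R[i]]_n) p : pdmx A -> pdmx (mxpow A p).
Proof.
move=> pA; rewrite mxpowE; apply: spec_pd => [|i]; first exact: spectral_unit.
by rewrite powR_gt0// eigval_gt0.
Qed.

(** For Hermitian [M] this is a symmetric bilinear form over [R], the polar form of [qf M]. *)
Definition bf n (M : 'M[R[i]]_n) (x y : 'cV[R[i]]_n) : R :=
  complex.Re ((x ^h *m M *m y) 0 0).

Lemma qf_bf n (M : 'M[R[i]]_n) x : qf M x = bf M x x.
Proof. by []. Qed.

Lemma bfDr n (M : 'M[R[i]]_n) x y z : bf M x (y + z) = bf M x y + bf M x z.
Proof. by rewrite /bf mulmxDr mxE ReD. Qed.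

Lemma bfZr n (M : 'M[R[i]]_n) x l y : bf M x (l%:C *: y) = l * bf M x y.
Proof. by rewrite /bf -scalemxAr mxE ReZ. Qed.

Lemma bfC n (M : 'M[R[i]]_n) x y : M ^h = M -> bf M x y = bf M y x.
Proof.
move=> hM; rewrite /bf.
have -> : y ^h *m M *m x = (x ^h *m M *m y) ^h by rewrite !adjM adjK hM mulmxA.
by rewrite adj_mxE; case: (_ 0 0).
Qed.

Lemma bfMr n (M N : 'M[R[i]]_n) x y : bf (M *m N) x y = bf M x (N *m y).
Proof. by rewrite /bf !mulmxA. Qed.

Lemma bfMl n (M N : 'M[R[i]]_n) x y : bf (N ^h *m M) x y = bf M (N *m x) y.
Proof. by rewrite /bf adjM !mulmxA. Qed.

Lemma qf_addZ n (P : 'M[R[i]]_n) y l z : P ^h = P ->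
  qf P (y + l%:C *: z) = qf P y + l ^+ 2 * qf P z + 2 * l * bf P y z.
Proof.
move=> hP; rewrite !qf_bf bfDr bfZr ![bf P (_ + _) _]bfC// !bfDr !bfZr.
rewrite (bfC z y hP); move: (bf P y y) (bf P z z) (bf P y z) => a b c; ring.
Qed.

End QuadraticForms.

(** * Monotonicity of the geometric mean of positive definite matrices *)

Section Monotonicity.
Variable R : realType.
Implicit Types (m n : nat).

Lemma adj1 n : (1%:M : 'M[R[i]]_n) ^h = 1%:M.
Proof. by rewrite -adjE trmx1 map_mx1. Qed.

Lemma adj_inv n (P : 'M[R[i]]_n) : P \in unitmx -> P ^h = P ->
  (invmx P) ^h = invmx P.
Proof.
move=> uP hP; rewrite -[LHS](mulmxK uP) -{2}hP -adjM mulmxV//.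
by rewrite adj1 mul1mx.
Qed.

Lemma qf_inv n (P : 'M[R[i]]_n) x : pdmx P ->
  qf (invmx P) x = qf P (invmx P *m x).
Proof.
move=> pP; have uP := pd_unit pP; rewrite -qf_congr adj_inv//; last by case: pP.
by rewrite mulVmx// mul1mx.
Qed.

Lemma pd_inv n (P : 'M[R[i]]_n) : pdmx P -> pdmx (invmx P).
Proof.
move=> pP; have uP := pd_unit pP; split=> [|x x0]; first exact: adj_inv uP pP.1.
by rewrite qf_inv//; apply: pP.2; apply: unitary_mulx_neq0; rewrite ?unitmx_inv.
Qed.

(** Expanding the form of [P] at [y - z], which is nonnegative, gives
    [2 * qf Q y <= qf P y + qf P z], since [bf P y z = qf Q y]. *)
Lemma qf_dual n (P Q : 'M[R[i]]_n) y z : psdmx P -> P *m z = Q *m y ->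
  qf P y <= qf Q y -> qf Q y <= qf P z.
Proof.
move=> /psdmxP[hP pP] PzQy.
have yz : bf P y z = qf Q y by rewrite /bf -mulmxA PzQy mulmxA.
have := pP (y + (-1)%:C *: z).
rewrite (qf_addZ _ _ _ hP) yz {yz PzQy pP hP}.
move: (qf Q y) (qf P y) (qf P z) => a b c; lra.
Qed.

(** This is [qf_dual] at [y = Q^-1 x] and [z = P^-1 x], for which [P z = x = Q y]. *)
Lemma inv_anti n (P Q : 'M[R[i]]_n) : pdmx P -> pdmx Q ->
  (forall x, qf P x <= qf Q x) -> forall x, qf (invmx Q) x <= qf (invmx P) x.
Proof.
move=> pP pQ h x; have uP := pd_unit pP; have uQ := pd_unit pQ.
rewrite (qf_inv x pP) (qf_inv x pQ); apply: qf_dual (pd_psd pP) _ (h _).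
by rewrite !mulKVmx.
Qed.

Lemma pd_congr n (M N : 'M[R[i]]_n) :
  pdmx M -> N \in unitmx -> pdmx (N ^h *m M *m N).
Proof.
move=> [hM pM] uN; split=> [|x x0]; first by rewrite !adjM adjK hM mulmxA.
by rewrite qf_congr pM// unitary_mulx_neq0.
Qed.

Lemma psd_congr n (M N : 'M[R[i]]_n) : psdmx M -> psdmx (N ^h *m M *m N).
Proof.
move=> /psdmxP[hM pM]; apply/psdmxP; split=> [|x]; last by rewrite qf_congr.
by rewrite !adjM adjK hM mulmxA.
Qed.

(* If (Y - X) v = l v with l < 0, then the form of Y^2 - X^2 at v is
   l <(X + Y) v, v> < 0. *)
Lemma sqr_mono n (X Y : 'M[R[i]]_n) : pdmx X -> pdmx Y ->
  (forall x, qf (X *m X) x <= qf (Y *m Y) x) -> forall x, qf X x <= qf Y x.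
Proof.
move=> pX pY h; have [hX _] := pX; have [hY _] := pY.
have hD : (Y - X) ^h = Y - X by rewrite adjD adjN hX hY.
suff /psdmxP[_ pD] : psdmx (Y - X) by move=> x; have := pD x; rewrite qfB subr_ge0.
apply: herm_psd hD _ => v l v0 Dv; rewrite leNgt; apply/negP => l0.
have Yv : Y *m v = X *m v + l%:C *: v by rewrite -Dv mulmxBl subrKC.
have sq (Z : 'M[R[i]]_n) : Z ^h = Z -> qf (Z *m Z) v = qf 1%:M (Z *m v).
  by move=> hZ; rewrite -qf_congr hZ mulmx1.
have qYv : qf Y v = qf X v + l * qf 1%:M v.
  rewrite !qf_bf -[Y]mul1mx -[X]mul1mx [in LHS]bfMr Yv bfDr bfZr.
  by rewrite bfMr.
have := h v; rewrite (sq X hX) (sq Y hY) Yv qf_addZ; last exact: adj1.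
have -> : bf 1%:M (X *m v) v = qf X v by rewrite -bfMl hX mulmx1.
have pXv := pX.2 _ v0; have := pY.2 _ v0; rewrite qYv => pYv.
move: (qf 1%:M (X *m v)) (qf 1%:M v) (qf X v) pXv pYv => a b c c0 cl H.
have : l * (c + (c + l * b)) < 0 by rewrite nmulr_rlt0// addr_gt0.
nra.
Qed.

Lemma half2 : 2^-1 + 2^-1 = 1 :> R.
Proof. by field. Qed.

(** With [T = W^(1/2)], the square of [T X T] is [T (X W X) T]. So [sqr_mono] applies to [T X T] and
    [T Y T], and the congruence is undone by evaluating at [T^-1 x]. *)
Lemma mean_mono n (W X Y : 'M[R[i]]_n) : pdmx W -> pdmx X -> pdmx Y ->
  (forall x, qf (X *m W *m X) x <= qf (Y *m W *m Y) x) ->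
  forall x, qf X x <= qf Y x.
Proof.
move=> pW pX pY h; have [T pT TT] : exists2 T, pdmx T & T *m T = W.
  exists (mxpow W (2^-1)); first exact: mxpow_pd.
  by rewrite mxpowD// half2 mxpow1//; exact: pd_psd.
have uT := pd_unit pT; have [hT _] := pT.
have key Z : T *m Z *m T *m (T *m Z *m T) = T ^h *m (Z *m W *m Z) *m T.
  by rewrite hT -TT !mulmxA.
have cong Z : pdmx Z -> pdmx (T *m Z *m T).
  by move=> pZ; rewrite -{1}hT; exact: pd_congr.
have H' x : qf (T *m X *m T *m (T *m X *m T)) x <= qf (T *m Y *m T *m (T *m Y *m T)) x.
  by rewrite !key !qf_congr.
have H x := sqr_mono (cong X pX) (cong Y pY) H' x.
have back Z x : qf (T *m Z *m T) (invmx T *m x) = qf Z x.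
  by rewrite -{1}hT qf_congr mulKVmx.
by move=> x; have := H (invmx T *m x); rewrite !back.
Qed.

Lemma wgmean_pd_pd n (A B : 'M[R[i]]_n) nu : pdmx A -> pdmx B ->
  pdmx (wgmean_pd A B nu).
Proof.
move=> pA pB; rewrite /wgmean_pd.
have hT p := mxpow_adj A p; have uT p := pd_unit (mxpow_pd p pA).
rewrite -{1}(hT (2^-1)); apply: pd_congr => //.
by apply: mxpow_pd; rewrite -{1}hT; exact: pd_congr.
Qed.

Lemma pd_ratio n (A B : 'M[R[i]]_n) : pdmx A -> pdmx B ->
  pdmx (mxpow A (- 2^-1) *m B *m mxpow A (- 2^-1)).
Proof.
move=> pA pB; rewrite -{1}(mxpow_adj A); apply: pd_congr => //.
exact: pd_unit (mxpow_pd _ pA).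
Qed.

Lemma mxpowNK n (A : 'M[R[i]]_n) p : pdmx A -> mxpow A p *m mxpow A (- p) = 1%:M.
Proof. by move=> pA; rewrite mxpowD// subrr mxpow0. Qed.

Lemma mxpowKN n (A : 'M[R[i]]_n) p : pdmx A -> mxpow A (- p) *m mxpow A p = 1%:M.
Proof. by move=> pA; rewrite mxpowD// addNr mxpow0. Qed.

Lemma wgmean_pd0 n (A B : 'M[R[i]]_n) : pdmx A -> wgmean_pd A B 0 = A.
Proof.
move=> pA; rewrite /wgmean_pd mxpow0 mulmx1 mxpowD// half2 mxpow1//.
exact: pd_psd.
Qed.

Lemma wgmean_pd1 n (A B : 'M[R[i]]_n) : pdmx A -> pdmx B -> wgmean_pd A B 1 = B.
Proof.
move=> pA pB; rewrite /wgmean_pd mxpow1; last exact/pd_psd/pd_ratio.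
have := mxpowKN (2^-1) pA; have := mxpowNK (2^-1) pA.
move: (mxpow A (2^-1)) (mxpow A (- 2^-1)) => T S TS ST.
have -> : T *m (S *m B *m S) *m T = T *m S *m B *m (S *m T) by rewrite !mulmxA.
by rewrite TS ST mulmx1 mul1mx.
Qed.

(** Here [T] and [S] stand for [A^(1/2)] and [A^(-1/2)], the [C]'s for powers of [S B S], and [Ca']
    for the inverse of [Ca]. The inner factors [T S] and [S T] cancel. *)
Lemma mid_algebra n (S T Ca Cb Cc Ca' : 'M[R[i]]_n) :
  S *m T = 1%:M -> T *m S = 1%:M -> Ca *m Ca' = 1%:M ->
  Cc *m Ca' *m Cc = Cb -> T *m Ca *m T \in unitmx ->
  T *m Cc *m T *m invmx (T *m Ca *m T) *m (T *m Cc *m T) = T *m Cb *m T.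
Proof.
move=> ST TS CaK CcE uF.
have -> : invmx (T *m Ca *m T) = S *m Ca' *m S.
  have E : T *m Ca *m T *m (S *m Ca' *m S) = 1%:M.
    have -> : T *m Ca *m T *m (S *m Ca' *m S) = T *m (Ca *m (T *m S) *m Ca') *m S.
      by rewrite !mulmxA.
    by rewrite TS mulmx1 CaK mulmx1.
  by rewrite -[RHS](mulKmx uF) E mulmx1.
have -> : T *m Cc *m T *m (S *m Ca' *m S) *m (T *m Cc *m T)
        = T *m (Cc *m (T *m S) *m Ca' *m (S *m T) *m Cc) *m T by rewrite !mulmxA.
by rewrite TS ST !mulmx1 CcE.
Qed.

Lemma wgmean_pd_mid n (A B : 'M[R[i]]_n) a b c : pdmx A -> pdmx B ->
  c + c = a + b ->
  wgmean_pd A B c *m invmx (wgmean_pd A B a) *m wgmean_pd A B c = wgmean_pd A B b.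
Proof.
move=> pA pB cab; have pC := pd_ratio pA pB.
have uF : wgmean_pd A B a \in unitmx by exact/pd_unit/wgmean_pd_pd.
apply: (mid_algebra (mxpowKN _ pA) (mxpowNK _ pA) (mxpowNK _ pC) _ uF).
(* Powers of the same matrix multiply by adding exponents, and [c - a + c = b]. *)
rewrite (mxpowD _ _ pC) (mxpowD _ _ pC); congr mxpow.
by rewrite addrAC cab addrAC subrr add0r.
Qed.

Lemma wgmean_pd_mid_mono n (A B A' B' : 'M[R[i]]_n) a b c :
  pdmx A -> pdmx B -> pdmx A' -> pdmx B' -> c + c = a + b ->
  (forall x, qf (wgmean_pd A B a) x <= qf (wgmean_pd A' B' a) x) ->
  (forall x, qf (wgmean_pd A B b) x <= qf (wgmean_pd A' B' b) x) ->
  forall x, qf (wgmean_pd A B c) x <= qf (wgmean_pd A' B' c) x.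
Proof.
move=> pA pB pA' pB' cab.
have := wgmean_pd_mid pA pB cab; have := wgmean_pd_mid pA' pB' cab.
have := wgmean_pd_pd a pA pB; have := wgmean_pd_pd c pA pB.
have := wgmean_pd_pd a pA' pB'; have := wgmean_pd_pd c pA' pB'.
move: (wgmean_pd A B a) (wgmean_pd A B b) (wgmean_pd A B c) => Fa Fb Fc.
move: (wgmean_pd A' B' a) (wgmean_pd A' B' b) (wgmean_pd A' B' c) => Ga Gb Gc.
move=> pGc pGa pFc pFa GE FE ha hb.
(* The chain is [Fc Ga^-1 Fc <= Fc Fa^-1 Fc = Fb <= Gb = Gc Ga^-1 Gc]; its first step holds because
   inversion reverses [Fa <= Ga]. *)
apply: (mean_mono (pd_inv pGa)) => // x.
apply: (@le_trans _ _ (qf (Fc *m invmx Fa *m Fc) x)); last by rewrite FE GE.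
have [hFc _] := pFc; rewrite -{1 3}hFc !qf_congr.
exact: inv_anti.
Qed.

(** Induction on [k]: [j / 2^(k+1)] is the midpoint of the two weights obtained by rounding [j / 2]
    down and up over [2^k]. At level 0 the weights are 0 and 1, where the means are [A] and [B]. *)
Lemma wgmean_pd_dyadic n (A B A' B' : 'M[R[i]]_n) :
  pdmx A -> pdmx B -> pdmx A' -> pdmx B' ->
  (forall x, qf A x <= qf A' x) -> (forall x, qf B x <= qf B' x) ->
  forall k j x, (j <= 2 ^ k)%N ->
  qf (wgmean_pd A B (j%:R / 2 ^+ k)) x <= qf (wgmean_pd A' B' (j%:R / 2 ^+ k)) x.
Proof.
move=> pA pB pA' pB' hA hB; elim=> [|k IH] j x jk.
  have : (j == 1)%N || (j == 0)%N by move: jk; rewrite expn0; case: (j) => [|[]].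
  case/orP => /eqP ->; last first.
    have -> : 0%:R / 2 ^+ 0 = 0 :> R by rewrite mul0r.
    by rewrite (wgmean_pd0 B pA) (wgmean_pd0 B' pA').
  have -> : 1%:R / 2 ^+ 0 = 1 :> R by rewrite expr0 divr1.
  by rewrite (wgmean_pd1 pA pB) (wgmean_pd1 pA' pB').
have j2 : (j./2 + uphalf j = j)%N by rewrite uphalf_half addnCA addnn odd_double_half.
have h1 : (j./2 <= 2 ^ k)%N by rewrite leq_half_double (leq_trans jk)// expnS mul2n.
have h2 : (uphalf j <= 2 ^ k)%N by rewrite leq_uphalf_double -mul2n -expnS.
apply: (wgmean_pd_mid_mono pA pB pA' pB' _ (fun y => IH j./2 y h1)
  (fun y => IH (uphalf j) y h2)).
rewrite -[RHS]mulrDl -[in RHS]natrD j2 exprS; field.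
by rewrite expf_neq0.
Qed.

End Monotonicity.

(** * Expansion of the mean in powers of the weight, and monotonicity for all weights in [0,1] *)

Section PowerSums.
Variable R : realType.
Local Open Scope classical_set_scope.
Local Open Scope complex_scope.

(** A zero eigenvalue would have a nonzero eigenvector killed by the invertible [A]. *)
Lemma psd_unit_pd n (A : 'M[R[i]]_n) : psdmx A -> A \in unitmx -> pdmx A.
Proof.
move=> pA uA; have [hA _] := (psdmxP A).1 pA.
rewrite (spectral_specE hA); apply: spec_pd => [|i]; first exact: spectral_unit.
rewrite lt_neqAle eigval_ge0// andbT eq_sym; apply/eqP => d0.
have [v0 [Av _]] := eigvalE i hA.
have := unitary_mulx_neq0 uA v0; rewrite Av d0.
by have -> : (0 : R)%:C = 0 by []; rewrite scale0r eqxx.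
Qed.

Lemma pd_1 n : pdmx (1%:M : 'M[R[i]]_n).
Proof.
have := spec_pd (spectral_unit (1%:M : 'M[R[i]]_n)) (fun=> ltr01).
by rewrite (spec1 (spectral_unitarymx _)).
Qed.

Lemma qf_shift n (A : 'M[R[i]]_n) (e : R) x :
  qf (A + e%:C%:M) x = qf A x + e * qf 1%:M x.
Proof. by rewrite qfD -(scalemx1 n e%:C) qfZ. Qed.

Lemma shift_pd n (A : 'M[R[i]]_n) (e : R) : psdmx A -> 0 < e -> pdmx (A + e%:C%:M).
Proof.
move=> /psdmxP[hA pA] e0; split=> [|x x0].
  by rewrite adjD hA -(scalemx1 n e%:C) adjZ adj1.
by rewrite qf_shift ltr_wpDl// mulr_gt0// (pd_1 n).2.
Qed.

Lemma wgmean_pd_adj n (A B : 'M[R[i]]_n) t : (wgmean_pd A B t)^h = wgmean_pd A B t.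
Proof.
rewrite /wgmean_pd; have := mxpow_adj A (2^-1).
have := mxpow_adj (mxpow A (- 2^-1) *m B *m mxpow A (- 2^-1)) t.
move: (mxpow _ t) (mxpow A (2^-1)) => C T hC hT.
by rewrite !adjM hC hT mulmxA.
Qed.

(** The base 0 is allowed because [B] may be singular when [A] is invertible. *)
Definition powsum (phi : R -> R) := exists n (c l : 'I_n -> R),
  [/\ forall i, 0 <= c i, forall i, 0 <= l i
    & phi = fun t => \sum_i c i * l i `^ t].

(** The coefficients are the squared moduli of the coordinates of [A^(1/2) x] in an eigenbasis of
    [C]. Neither depends on [t], so one family [c] serves all weights. *)
Lemma qf_wgmean_pd n (A B : 'M[R[i]]_n) x : 
  let C := mxpow A (- 2^-1) *m B *m mxpow A (- 2^-1) in
  exists2 c : 'I_n -> R, forall i, 0 <= c i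
    & forall t, qf (wgmean_pd A B t) x = \sum_i c i * eigval C i `^ t.
Proof.
move=> C.
exists (fun i => nsq ((spectralmx C *m (mxpow A (2^-1) *m x)) i 0)).
  by move=> i; exact: nsq_ge0.
move=> t; rewrite /wgmean_pd -/C.
have := mxpow_adj A (2^-1); move: (mxpow A (2^-1)) => T hT.
rewrite -{1}hT qf_congr mxpowE qf_spec.
by apply: eq_bigr => i _; rewrite mulrC.
Qed.

Lemma wgmean_pd_powsum n (A B : 'M[R[i]]_n) x : pdmx A -> psdmx B ->
  powsum (fun t => qf (wgmean_pd A B t) x).
Proof.
move=> pA pB; have [c c0 E] := qf_wgmean_pd A B x.
exists n, c, (eigval (mxpow A (- 2^-1) *m B *m mxpow A (- 2^-1))).
split=> // [i|]; last exact/funext.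
by apply: eigval_ge0; rewrite -{1}(mxpow_adj A); exact: psd_congr.
Qed.

Lemma cvg_sumr (T : Type) (F : set_system T) (FF : Filter F) (I : Type)
    (r : seq I) (P : pred I) (f : I -> T -> R) (l : I -> R) :
  (forall i, P i -> f i x @[x --> F] --> l i) ->
  \sum_(i <- r | P i) f i x @[x --> F] --> \sum_(i <- r | P i) l i.
Proof. by apply: cvg_big; exact: add_continuous. Qed.

Lemma powR_continuous (l : R) : 0 < l -> continuous (powR l).
Proof.
move=> l0; have -> : powR l = expR \o (fun t => t * ln l).
  by apply/funext => t; rewrite /powR gt_eqF.
move=> t; apply: continuous_comp; last exact: continuous_expR.
by apply: cvgM; [exact: cvg_id|exact: cvg_cst].
Qed.

Lemma wgmean_pd_continuous n (A B : 'M[R[i]]_n) x : pdmx A -> pdmx B ->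
  continuous (fun t => qf (wgmean_pd A B t) x).
Proof.
move=> pA pB; have [c c0 E] := qf_wgmean_pd A B x.
rewrite (funext E) => t; apply: cvg_sumr => i _; apply: cvgM; first exact: cvg_cst.
by apply: powR_continuous; apply: eigval_gt0; exact: pd_ratio.
Qed.

(** The dyadic number [u k], rounded down from [t], lies between [t - 2^-k] and [t]; hence it tends
    to [t], and [t <= 1] keeps its numerator at most [2^k]. *)
Lemma dyadic_closed (g : R -> R) : continuous g ->
  (forall k j, (j <= 2 ^ k)%N -> 0 <= g (j%:R / 2 ^+ k)) ->
  forall t, 0 <= t <= 1 -> 0 <= g t.
Proof.
move=> cg gd t /andP[t0 t1].
pose u k : R := (Num.trunc (t * 2 ^+ k))%:R / 2 ^+ k.
have p2 k : (0 : R) < 2 ^+ k by rewrite exprn_gt0.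
have ut : u k @[k --> \oo] --> t.
  have h : (t - geometric 1 2^-1 k) @[k --> \oo] --> t.
    rewrite -[X in _ --> X]subr0; apply: cvgB; first exact: cvg_cst.
    by apply: cvg_geometric; rewrite ger0_norm ?invf_lt1 ?invr_ge0// ltr1n.
  apply: (squeeze_cvgr _ h (cvg_cst t)).
  apply: nearW => k; rewrite /u /geometric /= mul1r exprVn.
  have /andP[h1 h2] := truncn_itv (mulr_ge0 t0 (ltW (p2 k))).
  rewrite ler_pdivrMr// h1 andbT ler_pdivlMr// mulrBl mulVf ?gt_eqF//.
  by rewrite lerBlDr natr1 ltW.
have /cvg_lim <- // : (g \o u) k @[k --> \oo] --> g t.
  exact: (continuous_cvg _ (cg t) ut).
apply: limr_ge; first by apply/cvg_ex; exists (g t); exact: (continuous_cvg _ (cg t) ut).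
apply: nearW => k; apply: gd.
rewrite -(ler_nat R) natrX.
have /andP[h1 _] := truncn_itv (mulr_ge0 t0 (ltW (p2 k))).
by rewrite (le_trans h1)// ler_piMl// ltW.
Qed.

Lemma wgmean_pd_mono n (A B A' B' : 'M[R[i]]_n) :
  pdmx A -> pdmx B -> pdmx A' -> pdmx B' ->
  (forall x, qf A x <= qf A' x) -> (forall x, qf B x <= qf B' x) ->
  forall t x, 0 <= t <= 1 ->
  qf (wgmean_pd A B t) x <= qf (wgmean_pd A' B' t) x.
Proof.
move=> pA pB pA' pB' hA hB t x t01; rewrite -subr_ge0.
apply: (dyadic_closed (g := fun t => qf (wgmean_pd A' B' t) x - qf (wgmean_pd A B t) x)) t01.
  by move=> s; apply: cvgB; exact: wgmean_pd_continuous.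
by move=> k j jk; rewrite subr_ge0; exact: wgmean_pd_dyadic.
Qed.

End PowerSums.

(** * The scalar inequalities *)

Section Exponential.
Variable R : realType.
Local Open Scope classical_set_scope.
Local Open Scope complex_scope.
Local Notation I01 := `[0%R, 1%R]%classic.
Local Notation mu := (@lebesgue_measure R).

Lemma expR_cosh_abs (s : R) : expR s + expR (- s) = expR `|s| + expR (- `|s|).
Proof. by case: (ger0P s) => // _; rewrite opprK addrC. Qed.

Lemma expR_cosh_le (s t : R) : `|s| <= `|t| ->
  expR s + expR (- s) <= expR t + expR (- t).
Proof.
rewrite (expR_cosh_abs s) (expR_cosh_abs t).
move: `|s| `|t| (normr_ge0 s) => {}s {}t s0 st.
rewrite !expRN; have a1 : 1 <= expR s by rewrite -expR0 ler_expR.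
have ab : expR s <= expR t by rewrite ler_expR.
move: (expR s) (expR t) a1 ab => a b a1 ab.
have a0 : 0 < a by apply: lt_le_trans a1.
have b0 : 0 < b by apply: lt_le_trans ab.
(* With [a] and [b] the exponentials of the absolute values, [1 <= a <= b] and the difference
   factors with nonnegative factors. *)
rewrite -subr_ge0.
have -> : b + b^-1 - (a + a^-1) = (b - a) * (a * b - 1) / (a * b).
  by field; rewrite !gt_eqF.
have ab1 : 1 <= a * b by rewrite -[1]mulr1 ler_pM// (le_trans a1).
by rewrite divr_ge0 ?mulr_ge0 ?subr_ge0// ltW.
Qed.

(** The difference of the two sides vanishes at 0, and its derivative [2 cosh t - 2] is nonnegative
    by [expR_cosh_le]. *)
Lemma expR_sinh_ge (y : R) : 0 <= y -> 2 * y <= expR y - expR (- y).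
Proof.
move=> y0; pose f (t : R) := expR t - expR (- t) - 2 * t.
have df (t : R) : is_derive t 1 f (expR t + expR (- t) - 2).
  have d1 := is_derive_expR t.
  have d2 : is_derive t (1 : R) (fun t : R => expR (- t)) (expR (- t) * -1).
    by apply: (is_derive1_comp (f := expR) (g := -%R)).
  have d3 : is_derive t (1 : R) (fun t : R => 2 * t) 2.
    rewrite -[X in is_derive _ _ _ X]mulr1.
    exact: (is_deriveZ (f := id) 2).
  have := is_deriveB (is_deriveB d1 d2) d3.
  by rewrite mulrN1 opprK.
have df1 (t : R) : derivable f t 1 by case: (df t).
have : f 0 <= f y.
  have h (t : R) : t \in `]0, y[%R -> 0 <= f^`() t.
    move=> _; rewrite derive1E; case: (df t) => _ ->.
    have := @expR_cosh_le 0 t; rewrite normr0 normr_ge0 oppr0 expR0 => /(_ isT).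
    by rewrite subr_ge0.
  apply: (ger0_derive1_ndecr (fun t _ => df1 t) h) => //.
  by apply: derivable_within_continuous => t _.
by rewrite /f oppr0 expR0; lra.
Qed.

Lemma continuous_integrable (f : R -> R) : continuous f ->
  mu.-integrable I01 (EFin \o f).
Proof.
move=> cf; apply: continuous_compact_integrable; first exact: segment_compact.
exact: continuous_subspaceT.
Qed.

Lemma Rintegral_expR (L : R) : L != 0 ->
  \int[mu]_(t in I01) expR (t * L) = (expR L - 1) / L.
Proof.
move=> L0; pose F (t : R) := L^-1 * expR (t * L).
have dF (t : R) : is_derive t 1 F (expR (t * L)).
  have d1 : is_derive t (1 : R) ( *%R^~ L) L.
    rewrite (_ : ( *%R^~ L) = L \*: (@id R)); last by apply/funext => s /=; rewrite mulrC.
    rewrite -[X in is_derive _ _ _ X]mulr1.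
    exact: (is_deriveZ (f := id) L).
  have d2 : is_derive t (1 : R) (fun t : R => expR (t * L)) (expR (t * L) * L).
    by apply: (is_derive1_comp (f := expR) (g := *%R^~ L)).
  have := is_deriveZ L^-1 d2.
  rewrite (_ : L^-1 *: _ = expR (t * L)) //.
  by rewrite /GRing.scale /= mulrC mulfK.
rewrite /Rintegral (@continuous_FTC2 _ _ F)//.
- by rewrite /F /= mul1r mul0r expR0; field.
- apply: continuous_subspaceT => t; apply: continuous_comp; last exact: continuous_expR.
  by apply: cvgM; [exact: cvg_id|exact: cvg_cst].
- have cF : continuous F by move=> t; apply: differentiable_continuous; apply/derivable1_diffP; case: (dF t).
  split=> [t _||]; first by case: (dF t).
  + exact/cvg_at_right_filter/cF.
  + exact/cvg_at_left_filter/cF.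
- by move=> t _; rewrite derive1E; case: (dF t).
Qed.

End Exponential.

(** * Node sums against the integral: exponentials, powers, nonnegative combinations and limits *)

Section HermiteHadamard.
Variable R : realType.
Local Open Scope classical_set_scope.
Local Open Scope complex_scope.
Local Notation I01 := `[0%R, 1%R]%classic.
Local Notation mu := (@lebesgue_measure R).

(** Twice each sum is the sum of its pairs, by the reversal of the index [k] into [m + 1 - k]. *)
Lemma ler_sum_sym m (F G : nat -> R) :
  (forall k, (1 <= k <= m)%N -> F k + F (m.+1 - k)%N <= G k + G (m.+1 - k)%N) ->
  \sum_(1 <= k < m.+1) F k <= \sum_(1 <= k < m.+1) G k.
Proof.
move=> h.
have sym H : (\sum_(1 <= k < m.+1) H k) *+ 2 =
             \sum_(1 <= k < m.+1) (H k + H (m.+1 - k)%N) :> R.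
  rewrite big_split mulr2n; congr (_ + _).
  by rewrite big_nat_rev; apply: eq_bigr => k _; rewrite add1n subSS.
rewrite -(ler_pMn2r (n := 2))// !sym !big_nat.
by apply: ler_sum => k /andP[k1 km]; apply: h; rewrite k1.
Qed.

Lemma mu_I01 : lebesgue_measure I01 = 1%:E :> \bar R.
Proof. by rewrite lebesgue_measure_itv /= lte_fin ltr01 oppr0 adde0. Qed.

(** The nodes are the centres of [m] equal subintervals of [0,1], so the left side is the midpoint
    rule. *)
Definition hh_integral m (phi : R -> R) :=
  m%:R^-1 * \sum_(1 <= k < m.+1) phi ((2 * k%:R - 1) / (2 * m%:R))
  <= \int[mu]_(t in I01) phi t.

Definition hh_midpoints m (phi : R -> R) :=
  m%:R^-1 * \sum_(1 <= k < m.+1) phi (k%:R / m.+1%:R)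
  <= m%:R^-1 * \sum_(1 <= k < m.+1) phi ((2 * k%:R - 1) / (2 * m%:R)).

Definition hh_center m (phi : R -> R) :=
  phi 2^-1 <= m%:R^-1 * \sum_(1 <= k < m.+1) phi (k%:R / m.+1%:R).

(** Integrability is carried along so that the integral splits over sums and the property is stable
    under nonnegative combinations. *)
Definition hh m phi := [/\ mu.-integrable I01 (EFin \o phi),
  hh_integral m phi, hh_midpoints m phi & hh_center m phi].

Lemma expR_pair_le (L c s t : R) : `|s| <= `|t| ->
  expR ((c + s) * L) + expR ((c - s) * L) <= expR ((c + t) * L) + expR ((c - t) * L).
Proof.
move=> st; rewrite !mulrDl !expRD -!mulrDr ler_wpM2l ?expR_ge0// !mulNr.
by apply: expR_cosh_le; rewrite !normrM ler_wpM2r.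
Qed.

Lemma hh_expR m (L : R) : (1 <= m)%N -> hh m (fun t : R => expR (t * L)).
Proof.
move=> m1.
have m0 : 0 < m%:R :> R by rewrite ltr0n.
have mS0 : 0 < m.+1%:R :> R by rewrite ltr0n.
have mS : m.+1%:R = m%:R + 1 :> R by rewrite -natr1.
have refl k : (1 <= k <= m)%N -> (m.+1 - k)%:R = m%:R + 1 - k%:R :> R.
  by move=> /andP[_ km]; rewrite natrB ?mS// ltnW.
(* Both families of nodes deviate from 1/2 by multiples of the same [d k], over [2m] and over
   [2(m + 1)]. Since [d] changes sign under [k -> m + 1 - k], paired nodes are symmetric about
   1/2. *)
pose d k : R := 2 * k%:R - 1 - m%:R.
have pE k : (2 * k%:R - 1) / (2 * m%:R) = 2^-1 + d k / (2 * m%:R) :> R.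
  by rewrite /d; field; rewrite gt_eqF.
have qE k : k%:R / m.+1%:R = 2^-1 + d k / (2 * m.+1%:R) :> R.
  by rewrite /d mS; field; rewrite -mS gt_eqF.
have dr k : (1 <= k <= m)%N -> d (m.+1 - k)%N = - d k.
  by move=> km; rewrite /d refl//; ring.
split.
- apply: continuous_integrable => t.
  apply: continuous_comp; last exact: continuous_expR.
  by apply: cvgM; [exact: cvg_id|exact: cvg_cst].
- rewrite /hh_integral.
  (* The closed form of the integral divides by [L]; for [L = 0] the function is constantly 1. *)
  have [->|L0] := eqVneq L 0.
    under eq_bigr do rewrite mulr0 expR0.
    under eq_Rintegral do rewrite mulr0 expR0.
    rewrite sumr_const_nat subn1 /= mulVf ?gt_eqF// Rintegral_cst//.
    by rewrite mul1r (congr1 fine mu_I01 : fine (mu I01) = 1).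
  rewrite Rintegral_expR//.
  (* Consecutive midpoint exponents differ by [2y]. Multiplying the k-th term by [s] gives
     [exp(2ky) - exp(2(k-1)y)], so the sum telescopes to [exp L - 1]. *)
  pose y := L / (2 * m%:R); pose s := expR y - expR (- y).
  have y0 : y != 0 by rewrite mulf_neq0// invr_neq0// mulf_neq0// gt_eqF.
  have tele : s * \sum_(1 <= k < m.+1) expR ((2 * k%:R - 1) / (2 * m%:R) * L) = expR L - 1.
    rewrite big_add1 /= mulr_sumr.
    rewrite (eq_bigr (fun k => expR (k.+1%:R * (2 * y)) - expR (k%:R * (2 * y)))).
      rewrite telescope_sumr// mul0r expR0.
      by congr (expR _ - _); rewrite /y; field; rewrite gt_eqF.
    move=> k _; rewrite /s mulrBl -!expRD -natr1.
    by congr (expR _ - expR _); rewrite /y; field; rewrite gt_eqF.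
  have Lpos : 0 <= (expR L - 1) / L.
    have [Lp|Ln] := ltP 0 L.
      by rewrite divr_ge0 ?(ltW Lp)// subr_ge0 -expR0 ler_expR ltW.
    rewrite mulr_le0// ?invr_le0// subr_le0 -expR0 ler_expR//.
  have s0 : s != 0.
    rewrite /s subr_eq0; apply/eqP => /expR_inj /eqP.
    by rewrite -subr_eq0 opprK -mulr2n mulrn_eq0 (negPf y0).
  (* The ratio is [sinh y / y]. It is even in [y], so the negative case reduces to [expR_sinh_ge] at
     [- y]. *)
  have sy : 1 <= s / (2 * y).
    have [yp|yn] := ltP 0 y.
      have y2 : 0 < 2 * y by rewrite mulr_gt0.
      by rewrite ler_pdivlMr// mul1r expR_sinh_ge// ltW.
    have y2 : 0 < 2 * - y by rewrite mulr_gt0// oppr_gt0 lt_neqAle y0.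
    have -> : s / (2 * y) = (- s) / (2 * - y) by rewrite mulrN invrN mulrNN.
    rewrite ler_pdivlMr// mul1r.
    have := expR_sinh_ge (y := - y); rewrite oppr_ge0 yn opprK => /(_ isT).
    by rewrite /s opprB.
  have -> : (expR L - 1) / L = m%:R^-1 * (\sum_(1 <= k < m.+1)
      expR ((2 * k%:R - 1) / (2 * m%:R) * L)) * (s / (2 * y)).
    rewrite -tele /y; field; rewrite L0 gt_eqF//=.
  rewrite ler_peMr// mulr_ge0 ?invr_ge0 ?(ltW m0)//.
  by apply: sumr_ge0 => k _; exact: expR_ge0.
- rewrite /hh_midpoints ler_pM2l ?invr_gt0//; apply: ler_sum_sym => k km.
  rewrite !pE !qE dr// !mulNr; apply: expR_pair_le.
  rewrite !normrM ler_wpM2l// !gtr0_norm ?invr_gt0 ?mulr_gt0//.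
  by rewrite lef_pV2 ?posrE ?mulr_gt0// ler_pM2l// ler_nat.
- rewrite /hh_center ler_pdivlMl//.
  (* The central value is repeated [m] times, so that the pairing compares deviation 0 with
     [d k / (2(m + 1))]. *)
  have -> : m%:R * expR (2^-1 * L) = \sum_(1 <= k < m.+1) expR (2^-1 * L).
    by rewrite sumr_const_nat subn1 /= mulr_natl.
  apply: ler_sum_sym => k km; rewrite !qE dr// !mulNr.
  have := @expR_pair_le L 2^-1 0 (d k / (2 * m.+1%:R)).
  by rewrite addr0 subr0 normr0; apply.
Qed.

(** Strict positivity keeps the node away from the exponent 0; the upper bound keeps it in [0,1],
    where the means are controlled. *)
Lemma midpoint_itv m k : (1 <= k < m.+1)%N ->
  0 < ((2 * k%:R - 1) / (2 * m%:R) : R) <= 1.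
Proof.
move=> /andP[k1 km].
have m0 : 0 < m%:R :> R by rewrite ltr0n (leq_trans k1).
have k1' : 1 <= k%:R :> R by rewrite ler1n.
have km' : k%:R <= m%:R :> R by rewrite ler_nat.
have m2 : 0 < 2 * m%:R :> R by rewrite mulr_gt0.
by rewrite divr_gt0 ?ler_pdivrMr// ?mul1r; lra.
Qed.

Lemma uniform_itv m k : (1 <= k < m.+1)%N -> 0 < (k%:R / m.+1%:R : R) <= 1.
Proof.
move=> /andP[k1 km].
by rewrite divr_gt0 ?ltr0n// ler_pdivrMr ?ltr0n// mul1r ler_nat ltnW.
Qed.

(* 0 `^ 0 = 1, but none of the exponents in the sums is 0. *)
Lemma hh_powR0 m : hh m (@powR R 0).
Proof.
have z k : (1 <= k < m.+1)%N -> (0 : R) `^ ((2 * k%:R - 1) / (2 * m%:R)) = 0.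
  by move=> /midpoint_itv /andP[h _]; rewrite powR0// gt_eqF.
have z' k : (1 <= k < m.+1)%N -> (0 : R) `^ (k%:R / m.+1%:R) = 0.
  by move=> /uniform_itv /andP[h _]; rewrite powR0// gt_eqF.
have S1 : \sum_(1 <= k < m.+1) (0 : R) `^ ((2 * k%:R - 1) / (2 * m%:R)) = 0.
  by rewrite big_nat big1.
have S2 : \sum_(1 <= k < m.+1) (0 : R) `^ (k%:R / m.+1%:R) = 0.
  by rewrite big_nat big1.
split.
- apply: measurable_bounded_integrable => //.
  + by have := ltry (1 : R); rewrite -mu_I01.
  (* The power of 0 is 1 at exponent 0 and 0 elsewhere, so it is an indicator function. *)
  + rewrite (_ : powR 0 = \1_[set 0]); first exact: measurable_indic.
    apply/funext => t; rewrite indicE /powR eqxx; congr ((nat_of_bool _)%:R).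
    by apply/idP/idP; rewrite inE => /eqP.
  + exists 1; split=> // M M1 t _ /=; rewrite ger0_norm ?powR_ge0//.
    rewrite (le_trans _ (ltW M1))// /powR eqxx.
    by case: (t == 0).
- by rewrite /hh_integral S1 mulr0 Rintegral_ge0// => t _; exact: powR_ge0.
- by rewrite /hh_midpoints S1 S2.
- by rewrite /hh_center S2 mulr0 powR0// invr_eq0.
Qed.

Lemma hh_powR m (l : R) : (1 <= m)%N -> 0 <= l -> hh m (powR l).
Proof.
rewrite le_eqVlt => m1 /predU1P[<-|l0]; first exact: hh_powR0.
rewrite (_ : powR l = fun t => expR (t * ln l)); first exact: hh_expR.
by apply/funext => t; rewrite /powR gt_eqF.
Qed.

Lemma hh0 m : hh m (fun _ : R => 0 : R).
Proof.
split; [exact: integrable0|..];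
  rewrite /hh_integral /hh_midpoints /hh_center ?big1 ?mulr0//.
exact: Rintegral_ge0.
Qed.

Lemma hh_addZ m (c : R) (phi psi : R -> R) : 0 <= c -> hh m phi -> hh m psi ->
  hh m (fun t => c * phi t + psi t).
Proof.
move=> c0 [i1 h1 h2 h3] [i1' h1' h2' h3'].
have iZ : mu.-integrable I01 (EFin \o (fun t => c * phi t)).
  exact: (integrableZl _ c i1).
split.
- exact: (integrableD _ iZ i1').
- rewrite /hh_integral RintegralD// RintegralZl// big_split mulrDr -mulr_sumr mulrCA.
  by rewrite lerD// ler_wpM2l.
- rewrite /hh_midpoints !big_split !mulrDr -!mulr_sumr ![_ * (c * _)]mulrCA.
  by rewrite lerD// ler_wpM2l.
- rewrite /hh_center big_split mulrDr -mulr_sumr mulrCA.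
  by rewrite lerD// ler_wpM2l.
Qed.

Lemma hh_powsum m (phi : R -> R) : (1 <= m)%N -> powsum phi -> hh m phi.
Proof.
move=> m1 [n [c [l [c0 l0 ->]]]]; elim: (index_enum _) => [|i r IH].
  rewrite (_ : (fun t => _) = fun=> 0 : R); first exact: hh0.
  by apply/funext => t; rewrite big_nil.
rewrite (_ : (fun t => _) = fun t => c i * l i `^ t + \sum_(j <- r) c j * l j `^ t).
  by apply: hh_addZ => //; exact: hh_powR.
by apply/funext => t; rewrite big_cons.
Qed.

(** Dominated convergence with majorant [phi_ 0] handles the integral; the node sums are finite and
    their nodes lie in [0,1], so pointwise limits suffice for them. *)
Lemma hh_lim m (phi_ : nat -> R -> R) (phi : R -> R) :
  (forall k, hh m (phi_ k)) ->
  (forall t : R, 0 <= t <= 1 -> phi_ ^~ t @ \oo --> phi t) ->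
  (forall k (t : R), 0 <= t <= 1 -> 0 <= phi_ k t <= phi_ 0%N t) ->
  hh m phi.
Proof.
move=> hk cv bd.
have mk k : measurable_fun (I01 : set R) (phi_ k).
  by have [/measurable_int/measurable_EFinP] := hk k.
have itvI (t : R) : I01 t -> 0 <= t <= 1 by rewrite /= in_itv.
have mphi : measurable_fun (I01 : set R) phi.
  by apply: measurable_fun_cvg mk _ => t /itvI; exact: cv.
have [i0 _ _ _] := hk 0%N.
have [iphi _ limI] : [/\ mu.-integrable I01 (EFin \o phi),
    [sequence \int[mu]_(x in I01) `|(phi_ n x)%:E - (phi x)%:E|]_n @ \oo --> 0 &
    [sequence \int[mu]_(x in I01) (phi_ n x)%:E]_n @ \oo -->
      \int[mu]_(x in I01) (phi x)%:E]%E.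
  apply: (dominated_convergence _ _ _ _ i0) => //.
  - by move=> k; apply/measurable_EFinP; exact: mk.
  - by apply/measurable_EFinP; exact: mphi.
  - by apply: aeW => t /itvI t01; apply: cvg_EFin; [exact: nearW|exact: cv].
  - apply: aeW => t k /itvI /(bd k) /andP[h1 h2].
    by rewrite /= lee_fin ger0_norm.
have limR : \int[mu]_(x in I01) phi_ k x @[k --> \oo] --> \int[mu]_(x in I01) phi x.
  by apply: fine_cvg; rewrite fineK//; exact: integrable_fin_num.
have S1 : m%:R^-1 * (\sum_(1 <= k < m.+1) phi_ j ((2 * k%:R - 1) / (2 * m%:R)))
    @[j --> \oo] --> m%:R^-1 * \sum_(1 <= k < m.+1) phi ((2 * k%:R - 1) / (2 * m%:R)).
  apply: cvgM; first exact: cvg_cst.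
  rewrite big_nat; under eq_fun do rewrite big_nat.
  apply: cvg_sumr => k /midpoint_itv /andP[h1 h2].
  by apply: cv; rewrite h2 ltW.
have S2 : m%:R^-1 * (\sum_(1 <= k < m.+1) phi_ j (k%:R / m.+1%:R))
    @[j --> \oo] --> m%:R^-1 * \sum_(1 <= k < m.+1) phi (k%:R / m.+1%:R).
  apply: cvgM; first exact: cvg_cst.
  rewrite big_nat; under eq_fun do rewrite big_nat.
  apply: cvg_sumr => k /uniform_itv /andP[h1 h2].
  by apply: cv; rewrite h2 ltW.
split=> //.
- by apply: ler_cvg_to S1 limR _; apply: nearW => k; case: (hk k).
- by apply: ler_cvg_to S2 S1 _; apply: nearW => k; case: (hk k).
- have h2 : 0 <= (2^-1 : R) <= 1 by rewrite invr_ge0 ler0n /=; lra.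
  by apply: ler_cvg_to (cv _ h2) S2 _; apply: nearW => k; case: (hk k).
Qed.

End HermiteHadamard.

(** * Limits and integrals of Hermitian matrices *)

Section MatrixLimits.
Variable R : realType.
Local Open Scope classical_set_scope.
Local Open Scope complex_scope.
Local Notation I01 := `[0%R, 1%R]%classic.
Local Notation mu := (@lebesgue_measure R).

Lemma bf_polar n (M : 'M[R[i]]_n) y z : M ^h = M ->
  bf M y z = 4^-1 * (qf M (y + 1%:C *: z) - qf M (y + (-1)%:C *: z)).
Proof.
move=> hM; rewrite (qf_addZ _ _ _ hM) (qf_addZ _ _ _ hM).
move: (qf M y) (qf M z) (bf M y z) => a b c; lra.
Qed.

Lemma bf_delta n (M : 'M[R[i]]_n) i j :
  bf M (delta_mx i 0) (delta_mx j 0) = complex.Re (M i j).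
Proof.
rewrite /bf -adjE trmx_delta map_delta_mx -rowE -colE.
by rewrite !mxE.
Qed.

(** The factor [- 'i] turns an imaginary part into a real part, so that [bf] can read it. *)
Lemma bf_delta_Im n (M : 'M[R[i]]_n) i j :
  bf M (delta_mx i 0) ((- 'i)%C *: delta_mx j 0) = complex.Im (M i j).
Proof.
rewrite /bf -adjE trmx_delta map_delta_mx -rowE -scalemxAr -colE.
by rewrite !mxE; case: (M i j) => a b /=; ring.
Qed.

(** The four vectors do not depend on [M]. Hence convergence or integrability of all quadratic forms
    of a Hermitian family passes to its entries. *)
Lemma entry_polar n (i j : 'I_n) : exists v : 'I_4 -> 'cV[R[i]]_n,
  forall M : 'M[R[i]]_n, M ^h = M ->
  complex.Re (M i j) = 4^-1 * (qf M (v 0) - qf M (v 1)) /\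
  complex.Im (M i j) = 4^-1 * (qf M (v 2) - qf M (v 3)).
Proof.
pose y : 'cV[R[i]]_n := delta_mx i 0; pose z : 'cV[R[i]]_n := delta_mx j 0.
exists (fun k => nth 0 [:: y + 1%:C *: z; y + (-1)%:C *: z;
   y + 1%:C *: ((- 'i)%C *: z); y + (-1)%:C *: ((- 'i)%C *: z)] k).
move=> M hM; rewrite -bf_delta -bf_delta_Im.
by split; rewrite (bf_polar _ _ hM).
Qed.

Lemma qf_entries n (M : 'M[R[i]]_n) x : qf M x =
  \sum_i \sum_j (complex.Re (conjc (x i 0) * x j 0) * complex.Re (M i j)
               - complex.Im (conjc (x i 0) * x j 0) * complex.Im (M i j)).
Proof.
rewrite /qf -mulmxA mxE Re_sum; apply: eq_bigr => i _.
rewrite adj_mxE mxE mulr_sumr Re_sum; apply: eq_bigr => j _.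
move: (M i j) (x i 0) (x j 0) => [a b] [c d] [e f] /=; ring.
Qed.

Lemma herm_ReIm n (M : 'M[R[i]]_n) : M ^h = M <->
  forall i j, complex.Re (M j i) = complex.Re (M i j) /\
              complex.Im (M j i) = - complex.Im (M i j).
Proof.
split=> [hM i j|h].
  by rewrite -{1 3}hM adj_mxE; case: (M i j).
apply/matrixP => i j; rewrite adj_mxE.
have [] := h i j; case: (M j i) => a b; case: (M i j) => c d /= -> ->.
by rewrite opprK.
Qed.

(** Entrywise convergence comes first, by polarization, since [lim] is only meaningful for
    convergent functions; the form is then a fixed finite combination of entries. *)
Lemma mxlim_herm n (F : R -> 'M[R[i]]_n) : (forall e, (F e) ^h = F e) ->
  (forall x, cvg (qf (F e) x @[e --> 0^'+])) ->
  (mxlim_right0 F) ^h = mxlim_right0 F /\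
  forall x, qf (F e) x @[e --> 0^'+] --> qf (mxlim_right0 F) x.
Proof.
move=> hF cF.
have cRe i j : cvg (complex.Re (F e i j) @[e --> 0^'+]).
  have [v Ev] := entry_polar i j.
  under eq_fun do rewrite (Ev _ (hF _)).1.
  by apply: is_cvgM; [exact: is_cvg_cst|exact: is_cvgB].
have cIm i j : cvg (complex.Im (F e i j) @[e --> 0^'+]).
  have [v Ev] := entry_polar i j.
  under eq_fun do rewrite (Ev _ (hF _)).2.
  by apply: is_cvgM; [exact: is_cvg_cst|exact: is_cvgB].
split.
  apply/herm_ReIm => i j; rewrite !mxE /=.
  have E e := (herm_ReIm (F e)).1 (hF e) i j; split.
    by under eq_fun do rewrite (E _).1.
  by under eq_fun do rewrite (E _).2; rewrite limN.
move=> x; rewrite qf_entries; under eq_fun do rewrite qf_entries.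
apply: cvg_sumr => i _; apply: cvg_sumr => j _.
by apply: cvgB; (apply: cvgM; first exact: cvg_cst); rewrite mxE.
Qed.

Lemma Rintegral_sum (I : Type) (r : seq I) (f : I -> R -> R) :
  (forall i, mu.-integrable I01 (EFin \o f i)) ->
  mu.-integrable I01 (EFin \o (fun t => \sum_(i <- r) f i t)) /\
  \int[mu]_(t in I01) (\sum_(i <- r) f i t) = \sum_(i <- r) \int[mu]_(t in I01) f i t.
Proof.
move=> fi; elim: r => [|i r [IH1 IH2]].
  rewrite big_nil (_ : (fun t => _) = cst 0); last by apply/funext => t; rewrite big_nil.
  by split; [exact: integrable0|rewrite Rintegral_cst// mul0r].
rewrite big_cons -IH2.
rewrite (_ : (fun t => _) = (fun t => f i t + \sum_(j <- r) f j t)); last first.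
  by apply/funext => t; rewrite big_cons.
by rewrite RintegralD//; split=> //; exact: (integrableD _ (fi i) IH1).
Qed.

(** Polarization makes the entries integrable; after that the integral commutes with the finite sum
    that expresses the form through the entries. *)
Lemma mxint_herm n (F : R -> 'M[R[i]]_n) :
  (forall t, 0 <= t <= 1 -> (F t) ^h = F t) ->
  (forall x, mu.-integrable I01 (EFin \o (fun t => qf (F t) x))) ->
  (mxint01 F) ^h = mxint01 F /\
  forall x, qf (mxint01 F) x = \int[mu]_(t in I01) qf (F t) x.
Proof.
move=> hF iF.
have itvI (t : R) : t \in I01 -> 0 <= t <= 1 by rewrite inE /= in_itv.
have iB (f g : R -> R) c : mu.-integrable I01 (EFin \o f) ->
    mu.-integrable I01 (EFin \o g) ->
    mu.-integrable I01 (EFin \o (fun t => c * (f t - g t))).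
  by move=> fi gi; exact: (integrableZl _ c (integrableB _ fi gi)).
have iRe i j : mu.-integrable I01 (EFin \o (fun t => complex.Re (F t i j))).
  have [v Ev] := entry_polar i j.
  apply: eq_integrable (iB _ _ 4^-1 (iF (v 0)) (iF (v 1))) => // t /itvI t01.
  by rewrite /= (Ev _ (hF t t01)).1.
have iIm i j : mu.-integrable I01 (EFin \o (fun t => complex.Im (F t i j))).
  have [v Ev] := entry_polar i j.
  apply: eq_integrable (iB _ _ 4^-1 (iF (v 2)) (iF (v 3))) => // t /itvI t01.
  by rewrite /= (Ev _ (hF t t01)).2.
split.
  apply/herm_ReIm => i j; rewrite !mxE /=.
  have E t (t01 : 0 <= t <= 1) := (herm_ReIm (F t)).1 (hF t t01) i j; split.
    by apply: eq_Rintegral => t /itvI /E[].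
  rewrite -mulN1r -RintegralZl//.
  by apply: eq_Rintegral => t /itvI /E[_ ->]; rewrite mulN1r.
move=> x; rewrite qf_entries.
under eq_Rintegral do rewrite qf_entries.
have iE i j : mu.-integrable I01 (EFin \o (fun t =>
    complex.Re (conjc (x i 0) * x j 0) * complex.Re (F t i j)
  - complex.Im (conjc (x i 0) * x j 0) * complex.Im (F t i j))).
  apply: (integrableB _ (integrableZl _ _ (iRe i j)) (integrableZl _ _ (iIm i j))) => //.
have S i := Rintegral_sum (index_enum 'I_n) (iE i).
rewrite (Rintegral_sum _ (fun i => (S i).1)).2.
apply: eq_bigr => i _; rewrite (S i).2; apply: eq_bigr => j _.
rewrite RintegralB//; [|exact: (integrableZl _ _ (iRe i j))|exact: (integrableZl _ _ (iIm i j))].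
by rewrite !RintegralZl// !mxE.
Qed.

(** * Means of shifted matrices and the singular case *)

Lemma shift_mono n (A : 'M[R[i]]_n) (e f : R) x : e <= f ->
  qf (A + e%:C%:M) x <= qf (A + f%:C%:M) x.
Proof.
move=> ef; rewrite !qf_shift lerD2l ler_wpM2r//.
by have /psdmxP[_] := pd_psd (pd_1 R n); apply.
Qed.

Lemma wgmean_pd_shift_bound n (A B : 'M[R[i]]_n) (e f t : R) x :
  psdmx A -> psdmx B -> 0 < e -> e <= f -> 0 <= t <= 1 ->
  0 <= qf (wgmean_pd (A + e%:C%:M) (B + e%:C%:M) t) x
    <= qf (wgmean_pd (A + f%:C%:M) (B + f%:C%:M) t) x.
Proof.
move=> pA pB e0 ef t01; have f0 := lt_le_trans e0 ef.
have pAe := shift_pd pA e0; have pBe := shift_pd pB e0.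
have pAf := shift_pd pA f0; have pBf := shift_pd pB f0.
apply/andP; split.
  by have /psdmxP[_] := pd_psd (wgmean_pd_pd t pAe pBe); apply.
by apply: wgmean_pd_mono t01 => // y; exact: shift_mono.
Qed.

(** The form is nondecreasing in [e] and bounded below by 0, so it has a limit from the right at
    0. *)
Lemma wgmean_pd_shift_cvg n (A B : 'M[R[i]]_n) (t : R) x :
  psdmx A -> psdmx B -> 0 <= t <= 1 ->
  cvg (qf (wgmean_pd (A + e%:C%:M) (B + e%:C%:M) t) x @[e --> 0^'+]).
Proof.
move=> pA pB t01; apply: nondecreasing_at_right_is_cvgr; apply: nearW => y.
  move=> e f; rewrite !in_itv /= => /andP[e0 _] _ ef.
  by have /andP[] := wgmean_pd_shift_bound x pA pB e0 ef t01.
exists 0 => z [e /=]; rewrite in_itv /= => /andP[e0 _] <-.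
by have /andP[] := wgmean_pd_shift_bound x pA pB e0 (lexx e) t01.
Qed.

Lemma wgmean_singular n (A B : 'M[R[i]]_n) (t : R) : psdmx A -> psdmx B ->
  A \notin unitmx -> 0 <= t <= 1 ->
  (wgmean A B t) ^h = wgmean A B t /\
  forall x, qf (wgmean_pd (A + e%:C%:M) (B + e%:C%:M) t) x @[e --> 0^'+]
    --> qf (wgmean A B t) x.
Proof.
move=> pA pB uA t01; rewrite /wgmean (negPf uA).
apply: mxlim_herm => [e|x]; first exact: wgmean_pd_adj.
exact: wgmean_pd_shift_cvg.
Qed.

Lemma wgmean_adj n (A B : 'M[R[i]]_n) (t : R) : psdmx A -> psdmx B ->
  0 <= t <= 1 -> (wgmean A B t) ^h = wgmean A B t.
Proof.
move=> pA pB t01; have [uA|uA] := boolP (A \in unitmx).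
  by rewrite /wgmean uA wgmean_pd_adj.
by have [] := wgmean_singular pA pB uA t01.
Qed.

Lemma hh_wgmean n (A B : 'M[R[i]]_n) m x : psdmx A -> psdmx B -> (1 <= m)%N ->
  hh m (fun t : R => qf (wgmean A B t) x).
Proof.
move=> pA pB m1; have [uA|uA] := boolP (A \in unitmx).
  apply: hh_powsum => //; rewrite /wgmean uA.
  by apply: wgmean_pd_powsum => //; exact: psd_unit_pd.
(* The shifts decrease to 0 from [e_ 0 = 1], whose mean dominates all the others on [0,1]. *)
pose e_ k : R := k.+1%:R^-1.
have e0 k : 0 < e_ k by rewrite invr_gt0.
apply: (hh_lim (phi_ := fun k t =>
  qf (wgmean_pd (A + (e_ k)%:C%:M) (B + (e_ k)%:C%:M) t) x)).
- move=> k; apply: hh_powsum => //; apply: wgmean_pd_powsum; first exact: shift_pd.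
  by apply: pd_psd; exact: shift_pd.
- move=> t t01; have [_ /(_ x)/cvg_at_rightP] := wgmean_singular pA pB uA t01.
  by apply; split => //; exact: cvg_harmonic.
- move=> k t t01; apply: wgmean_pd_shift_bound => //.
  by rewrite /e_ lef_pV2 ?posrE// ler_nat.
Qed.

Lemma qf_mean n m (F : nat -> 'M[R[i]]_n) x :
  qf (m%:R^-1 *: \sum_(1 <= k < m.+1) F k) x =
  m%:R^-1 * \sum_(1 <= k < m.+1) qf (F k) x.
Proof.
have -> : m%:R^-1 = (m%:R^-1)%:C :> R[i] by rewrite fmorphV rmorph_nat.
by rewrite qfZ qf_sum.
Qed.

Lemma adj_mean n m (F : nat -> 'M[R[i]]_n) :
  (forall k, (1 <= k < m.+1)%N -> (F k) ^h = F k) ->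
  (m%:R^-1 *: \sum_(1 <= k < m.+1) F k) ^h = m%:R^-1 *: \sum_(1 <= k < m.+1) F k.
Proof.
move=> hF; have -> : m%:R^-1 = (m%:R^-1)%:C :> R[i] by rewrite fmorphV rmorph_nat.
by rewrite adjZ !big_nat adj_sum.
Qed.

End MatrixLimits.

Theorem proposition4p2 (R : realType) (n : nat) (A B : 'M[R[i]]_n) (m : nat)
    (hA : psdmx A) (hB : psdmx B) (hm : (1 <= m)%N) :
  [/\ loewner_le
        (m%:R^-1 *: \sum_(1 <= k < m.+1)
                       wgmean A B ((2 * k%:R - 1) / (2 * m%:R)))
        (mxint01 (fun nu : R => wgmean A B nu)),
      loewner_le
        (m%:R^-1 *: \sum_(1 <= k < m.+1) wgmean A B (k%:R / (m.+1)%:R))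
        (m%:R^-1 *: \sum_(1 <= k < m.+1)
                       wgmean A B ((2 * k%:R - 1) / (2 * m%:R)))
    & loewner_le
        (wgmean A B (2^-1))
        (m%:R^-1 *: \sum_(1 <= k < m.+1) wgmean A B (k%:R / (m.+1)%:R))].
Proof.
have hh_ x := hh_wgmean x hA hB hm.
(* To compare quadratic forms through [loewnerP], all four matrices must first be shown
   Hermitian. *)
have [hI qI] : (mxint01 (fun nu : R => wgmean A B nu)) ^h =
    mxint01 (fun nu : R => wgmean A B nu) /\ forall x,
    qf (mxint01 (fun nu : R => wgmean A B nu)) x =
    \int[lebesgue_measure]_(t in `[0%R, 1%R]%classic) qf (wgmean A B t) x.
  apply: mxint_herm => [t t01|x]; first exact: wgmean_adj.
  by case: (hh_ x).
have hp : (m%:R^-1 *: \sum_(1 <= k < m.+1)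
    wgmean A B ((2 * k%:R - 1) / (2 * m%:R)))^h =
    m%:R^-1 *: \sum_(1 <= k < m.+1) wgmean A B ((2 * k%:R - 1) / (2 * m%:R)).
  apply: adj_mean => k /(midpoint_itv R) /andP[h1 h2].
  by apply: wgmean_adj => //; rewrite h2 ltW.
have hq : (m%:R^-1 *: \sum_(1 <= k < m.+1) wgmean A B (k%:R / m.+1%:R))^h =
    m%:R^-1 *: \sum_(1 <= k < m.+1) wgmean A B (k%:R / m.+1%:R).
  apply: adj_mean => k /(uniform_itv R) /andP[h1 h2].
  by apply: wgmean_adj => //; rewrite h2 ltW.
have hc : (wgmean A B 2^-1)^h = wgmean A B 2^-1.
  by apply: wgmean_adj => //; rewrite invr_ge0 ler0n /=; lra.
split.
- apply/(loewnerP hp hI) => x; have [_ h _ _] := hh_ x.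
  by rewrite qI qf_mean; exact: h.
- apply/(loewnerP hq hp) => x; have [_ _ h _] := hh_ x.
  by rewrite [X in X <= _]qf_mean [X in _ <= X]qf_mean; exact: h.
- apply/(loewnerP hc hq) => x; have [_ _ _ h] := hh_ x.
  by rewrite [X in _ <= X]qf_mean; exact: h.
Qed.
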